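(* Let $G$ be a Hausdorff, ample groupoid, and let $R$ be a commutative ring with identity $1 \neq 0$. Then $A_R(G)$ is basically simple if and only if $G$ is effective and minimal.
   Context: Groupoids: for a groupoid $G$, $r(\alpha)=\alpha\alpha^{-1}$ and $s(\alpha)=\alpha^{-1}\alpha$ are the range and source maps, their common image is the unit space $G^{(0)} \subseteq G$, and $\alpha\beta$ is defined iff $s(\alpha)=r(\beta)$. A topological groupoid is a groupoid with a topology making composition and inversion continuous. An open bisection is an open set $B \subseteq G$ such that $r|_B$ and $s|_B$ are homeomorphisms onto open subsets of $G^{(0)}$. $G$ is ample if it has a basis of compact open bisections. Let $\operatorname{Iso}(G)=\{\gamma\in G : s(\gamma)=r(\gamma)\}$; $G$ is effective if the interior of $\operatorname{Iso}(G)\setminus G^{(0)}$ is empty. A subset $U\subseteq G^{(0)}$ is invariant if $r(s^{-1}(U))=U$; $G$ is minimal if $G^{(0)}$ has no open invariant subsets other than $\emptyset$ and $G^{(0)}$. Steinberg algebra: for $G$ Hausdorff and ample, $A_R(G)$ is the $R$-algebra of all locally constant functions $f: G\to R$ with compact support, with pointwise addition and scalar multiplication and product the convolution $(f*g)(\alpha)=\sum_{r(\beta)=r(\alpha)} f(\beta)g(\beta^{-1}\alpha)$ (a sum with finitely many nonzero terms). For a compact open set $K\subseteq G$ (for instance $K \subseteq G^{(0)}$, which is open in $G$), $1_K \in A_R(G)$ denotes its characteristic function. Basic simplicity: a (two-sided) ideal $I$ of $A_R(G)$ is a basic ideal if, whenever $r1_K\in I$ for some $r\in R\setminus\{0\}$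 and some compact open $K\subseteq G^{(0)}$, one has $1_K\in I$. $A_R(G)$ is basically simple if it has no basic ideals other than (possibly) $\{0\}$ and $A_R(G)$. *)

(* Defs.v *)
From HB Require Import structures.
From mathcomp Require Import all_boot all_order all_algebra.
From mathcomp Require Import all_classical all_reals all_analysis.

Set Implicit Arguments.
Unset Strict Implicit.
Unset Printing Implicit Defensive.

Import GRing.Theory.
Local Open Scope classical_set_scope.
Local Open Scope ring_scope.

(** The partial product of a groupoid is encoded by a total function [mul] that
    is only meaningful on pairs with [s x = r y]; its other values are junk on
    which no axiom depends.  The axioms are the usual ones of a groupoid given
    by a partial product and an inversion, with the set of composable pairs
    taken to be [{(x, y) | s x = r y}]. *)
Definition composable_for (G : Type) (mul : G -> G -> G) (inv : G -> G)
    (x y : G) : Prop :=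
  mul (inv x) x = mul y (inv y).

HB.mixin Record isGroupoid (G : Type) := {
  gpd_mul : G -> G -> G;
  gpd_inv : G -> G;
  gpd_invK : forall x, gpd_inv (gpd_inv x) = x;
  gpd_composableMl : forall x y z,
    composable_for gpd_mul gpd_inv x y -> composable_for gpd_mul gpd_inv y z ->
    composable_for gpd_mul gpd_inv (gpd_mul x y) z;
  gpd_composableMr : forall x y z,
    composable_for gpd_mul gpd_inv x y -> composable_for gpd_mul gpd_inv y z ->
    composable_for gpd_mul gpd_inv x (gpd_mul y z);
  gpd_mulA : forall x y z,
    composable_for gpd_mul gpd_inv x y -> composable_for gpd_mul gpd_inv y z ->
    gpd_mul x (gpd_mul y z) = gpd_mul (gpd_mul x y) z;
  gpd_mulKl : forall x y,
    composable_for gpd_mul gpd_inv x y -> gpd_mul (gpd_inv x) (gpd_mul x y) = y;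
  gpd_mulKr : forall x y,
    composable_for gpd_mul gpd_inv x y -> gpd_mul (gpd_mul x y) (gpd_inv y) = x
}.

#[short(type="groupoidType")]
HB.structure Definition Groupoid := {G of isGroupoid G}.

Definition gpd_rng (G : groupoidType) (x : G) : G := gpd_mul x (gpd_inv x).
Definition gpd_src (G : groupoidType) (x : G) : G := gpd_mul (gpd_inv x) x.
Definition unit_space (G : groupoidType) : set G := range (@gpd_rng G).
Definition composable_pairs (G : groupoidType) : set (G * G) :=
  [set p | gpd_src p.1 = gpd_rng p.2].
Definition isotropy (G : groupoidType) : set G :=
  [set x | gpd_src x = gpd_rng x].
Definition invariant_set (G : groupoidType) (U : set G) : Prop :=
  @gpd_rng G @` (@gpd_src G @^-1` U) = U.

Arguments unit_space : clear implicits.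
Arguments composable_pairs : clear implicits.
Arguments isotropy : clear implicits.

HB.mixin Record isTopologicalGroupoid (G : Type)
    of Topological G & isGroupoid G := {
  gpd_mul_continuous :
    {within composable_pairs G, continuous (fun p : G * G => gpd_mul p.1 p.2)};
  gpd_inv_continuous : continuous (gpd_inv : G -> G)
}.

#[short(type="topologicalGroupoidType")]
HB.structure Definition TopologicalGroupoid :=
  {G of isTopologicalGroupoid G & Topological G & Groupoid G}.

Definition relatively_open (T : topologicalType) (A V : set T) : Prop :=
  V `<=` A /\ open (V : set (subspace A)).

(** [f] restricts to a homeomorphism from [A] onto [V]; [g] is (a total
    extension of) its inverse. *)
Definition homeomorphic_on (T : topologicalType) (A V : set T) (f : T -> T) :
    Prop :=
  [/\ {within A, continuous f},
      f @` A = V &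
      exists g : T -> T,
        (forall x, A x -> g (f x) = x) /\ {within V, continuous g}].

Definition open_bisection (G : topologicalGroupoidType) (B : set G) : Prop :=
  [/\ open B,
      exists2 V : set G, relatively_open (unit_space G) V &
        homeomorphic_on B V (@gpd_rng G) &
      exists2 V : set G, relatively_open (unit_space G) V &
        homeomorphic_on B V (@gpd_src G)].

Definition ample (G : topologicalGroupoidType) : Prop :=
  basis [set B : set G | compact B /\ open_bisection B].

Definition effective (G : topologicalGroupoidType) : Prop :=
  interior (isotropy G `\` unit_space G) = set0.

Definition minimal (G : topologicalGroupoidType) : Prop :=
  forall U : set G, relatively_open (unit_space G) U -> invariant_set U ->
    U = set0 \/ U = unit_space G.

Definition locally_constant (T : topologicalType) (S : Type) (f : T -> S) :
    Prop :=
  forall x, \forall y \near x, f y = f x.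

Definition compactly_supported (T : topologicalType) (R : nmodType)
    (f : T -> R) : Prop :=
  compact (closure [set x | f x != 0]).

(** The underlying set of the algebra [A_R(G)]; addition is the pointwise one of
    [G -> R] and multiplication is [convolution]. *)
Definition steinberg (R : comNzRingType) (G : topologicalGroupoidType) :
    set (G -> R) :=
  [set f | locally_constant f /\ compactly_supported f].

(** The library's finitely supported sum is [0] when infinitely many terms are
    nonzero, which does not happen for [f], [g] in [A_R(G)], [G] Hausdorff and
    ample. *)
Definition convolution (R : comNzRingType) (G : topologicalGroupoidType)
    (f g : G -> R) : G -> R :=
  fun a => \sum_(b \in [set b : G | gpd_rng b = gpd_rng a])
             (f b * g (gpd_mul (gpd_inv b) a)).

Definition two_sided_ideal (R : comNzRingType) (G : topologicalGroupoidType)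
    (I : set (G -> R)) : Prop :=
  [/\ I `<=` @steinberg R G,
      I 0,
      (forall f g, I f -> I g -> I (f - g)),
      (forall a f, @steinberg R G a -> I f -> I (convolution a f)) &
      (forall a f, @steinberg R G a -> I f -> I (convolution f a))].

Definition basic_ideal (R : comNzRingType) (G : topologicalGroupoidType)
    (I : set (G -> R)) : Prop :=
  two_sided_ideal I /\
  forall (r : R) (K : set G), r != 0 -> compact K -> open K ->
    K `<=` unit_space G -> I (fun x => r * \1_K x) -> I \1_K.

Definition basically_simple (R : comNzRingType) (G : topologicalGroupoidType) :
    Prop :=
  forall I : set (G -> R), basic_ideal I -> I = [set 0] \/ I = @steinberg R G.

Arguments steinberg : clear implicits.
Arguments basically_simple : clear implicits.

(* Main.v *)
Require Import Defs.
From mathcomp Require Import all_boot all_order all_algebra.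
From mathcomp Require Import all_classical all_reals all_analysis.

(** Convolving a nonzero element of an ideal with the indicator of a compact
    open bisection moves its support onto a unit.  If [G] is effective, a small
    compact open [K] around a nearby unit avoids the part of the support outside
    the unit space, so that [1_K * f * 1_K = c 1_K] with [c != 0]; a basic ideal
    then contains [1_K].  If [G] is minimal, conjugating [1_K] by bisections and
    taking unions yields every [1_L] with [L] a compact open set of units, and
    these are local units of the algebra.

    Conversely, an open invariant set [U] of units gives the basic ideal of
    functions vanishing off [s^-1 U]; and the kernel of the representation on
    the free module over the unit space, [f u = \sum_(s x = u) f(x) r(x)], is a
    basic ideal other than the whole algebra, which contains [1_B - 1_(r B)] for
    every compact open bisection [B] inside the isotropy. *)

Set Implicit Arguments.
Unset Strict Implicit.
Unset Printing Implicit Defensive.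

Import GRing.Theory.
Local Open Scope classical_set_scope.
Local Open Scope ring_scope.

(** * Induction over compact sets *)

Section compactness.
Context {T : topologicalType}.

(** If [P D] failed, the sets [A] for which [P] holds of [D] minus [A] would form a proper filter
    containing [D]. Near a cluster point in [D], some neighbourhood satisfies [P], so its complement
    belongs to the filter, which is absurd. *)
Lemma compact_ind (P : set T -> Prop) (D : set T) :
  P set0 -> (forall A B, P A -> P B -> P (A `|` B)) ->
  (forall A B, A `<=` B -> P B -> P A) ->
  compact D -> (forall x, D x -> exists2 U, nbhs x U & P U) -> P D.
Proof.
move=> P0 PU PS cD PD; apply: contrapT => nPD.
pose F : set_system T := [set A | P (D `\` A)].
have FF : ProperFilter F.
  apply: Build_ProperFilter; [by move=> /=; rewrite /F /= setD0|].
  split; [by rewrite /F /= setDT| |].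
  - by move=> A B PA PB; rewrite /F /= setDIr; apply: PU.
  - by move=> A B AB; apply: PS; apply: setDS.
have [|x [Dx clFx]] := cD F FF; first by rewrite /F /= setDv.
have [U Ux PUx] := PD x Dx.
have FU : F (~` U).
  by apply: PS PUx => y [_ /contrapT].
by have [y []] := clFx _ _ FU Ux.
Qed.

End compactness.

(** * Algebra of sources, ranges and inverses *)

Section groupoid_algebra.
Context {G : groupoidType}.
Implicit Types x y z : G.
Local Notation "x ** y" := (gpd_mul x y) (at level 40, left associativity).
Local Notation inv := gpd_inv.
Local Notation rg := (@gpd_rng _).
Local Notation sc := (@gpd_src _).

Lemma srcV x : sc (inv x) = rg x.
Proof. by rewrite /gpd_src gpd_invK. Qed.

Lemma rngV x : rg (inv x) = sc x.
Proof. by rewrite /gpd_rng gpd_invK. Qed.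

Lemma gpd_mulKV x y : sc x = rg y -> inv x ** (x ** y) = y.
Proof. exact: gpd_mulKl. Qed.

Lemma gpd_mulVK x y : rg x = rg y -> x ** (inv x ** y) = y.
Proof. by move=> h; rewrite -{1}(gpd_invK x) gpd_mulKV ?srcV. Qed.

Lemma gpd_mulK x y : sc x = rg y -> x ** y ** inv y = x.
Proof. exact: gpd_mulKr. Qed.

Lemma gpd_assoc x y z : sc x = rg y -> sc y = rg z ->
  x ** (y ** z) = x ** y ** z.
Proof. exact: gpd_mulA. Qed.

Lemma srcM x y : sc x = rg y -> sc (x ** y) = sc y.
Proof.
move=> h; rewrite -(rngV y); apply: gpd_composableMl => //.
by rewrite /composable_for gpd_invK.
Qed.

Lemma rngM x y : sc x = rg y -> rg (x ** y) = rg x.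
Proof.
move=> h; rewrite -(srcV x); apply/esym/gpd_composableMr => //.
by rewrite /composable_for gpd_invK.
Qed.

Lemma rng_mul x : rg x ** x = x.
Proof. by rewrite /gpd_rng -{3}(gpd_invK x) gpd_mulK// rngV. Qed.

Lemma mul_src x : x ** sc x = x.
Proof. by rewrite gpd_mulVK. Qed.

Lemma rng_rng x : rg (rg x) = rg x.
Proof. by rewrite [in LHS]/gpd_rng -/(rg _) rngM ?rngV. Qed.

Lemma src_rng x : sc (rg x) = rg x.
Proof. by rewrite {1}/gpd_rng srcM ?srcV ?rngV. Qed.

Lemma inv_rng x : inv (rg x) = rg x.
Proof. by rewrite -{1}(mul_src (inv _)) srcV rng_rng -/(sc _) src_rng. Qed.

Lemma unit_spaceP x : unit_space G x <-> rg x = x.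
Proof. by split=> [[y _ <-]|<-]; [rewrite rng_rng|exists x]. Qed.

Lemma unit_rng x : unit_space G (rg x).
Proof. by exists x. Qed.

Lemma unit_rngE x : unit_space G x -> rg x = x.
Proof. by move/unit_spaceP. Qed.

Lemma unit_srcE x : unit_space G x -> sc x = x.
Proof. by move=> /unit_spaceP <-; rewrite src_rng. Qed.

(** Multiplying the right-hand side by [x ** y] on the left gives [rg x], which is the source of
    [inv (x ** y)]; cancelling [x ** y] leaves the claim. *)
Lemma gpd_invM x y : sc x = rg y -> inv (x ** y) = inv y ** inv x.
Proof.
move=> h; have hw : sc y = rg (inv y ** inv x) by rewrite rngM ?rngV ?srcV.
rewrite -[RHS](@gpd_mulKV (x ** y)); last by rewrite srcM.
rewrite -gpd_assoc// gpd_mulVK ?rngV//.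
by rewrite -/(rg x) -(rngM h) -srcV mul_src.
Qed.

End groupoid_algebra.

(** * Topology of ample groupoids: open units, slices, openness of the range map *)

Lemma open_nbhsP (T : topologicalType) (A : set T) :
  (forall x, A x -> nbhs x A) -> open A.
Proof. by rewrite openE. Qed.

Lemma closed_equalizer (S T : topologicalType) (f g : S -> T) :
  hausdorff_space T -> continuous f -> continuous g ->
  closed [set x | f x = g x].
Proof.
rewrite open_hausdorff => hT cf cg; rewrite -openC; apply: open_nbhsP => x /= /eqP fgx.
have [[A B] /= [/set_mem Ax /set_mem Bx] [oA oB /eqP AB]] :=
  hT _ _ fgx.
have nA : nbhs x (f @^-1` A) by apply: cf; exact: open_nbhs_nbhs.
have nB : nbhs x (g @^-1` B) by apply: cg; exact: open_nbhs_nbhs.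
apply: filterS (filterI nA nB) => y [/= Ay By] fgy.
by have : (A `&` B) (f y) by [split=> //; rewrite fgy]; rewrite AB.
Qed.

Section topological_groupoid.
Context {G : topologicalGroupoidType}.
Implicit Types (x y z : G) (A B K : set G).
Local Notation "x ** y" := (gpd_mul x y) (at level 40, left associativity).
Local Notation inv := gpd_inv.
Local Notation rg := (@gpd_rng _).
Local Notation sc := (@gpd_src _).

(** Continuity on the subspace of composable pairs, unfolded so that the junk values of [gpd_mul]
    never enter. *)
Lemma nbhs_mul x y (W : set G) : sc x = rg y -> nbhs (x ** y) W ->
  exists U V, [/\ nbhs x U, nbhs y V &
    forall x' y', U x' -> V y' -> sc x' = rg y' -> W (x' ** y')].
Proof.
move=> xy Wxy.
have /subspace_continuousP /(_ (x, y) xy W Wxy) := @gpd_mul_continuous G.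
move=> [[U V] /= [Ux Vy] UV]; exists U, V; split => // x' y' Ux' Vy' xy'.
exact: (UV (x', y')).
Qed.

Lemma rng_continuous : continuous (rg : G -> G).
Proof.
move=> x W Wx; have xV : sc x = rg (inv x) by rewrite rngV.
have [U [V [Ux Vx UV]]] := nbhs_mul xV Wx.
have nV : nbhs x (inv @^-1` V) by exact: gpd_inv_continuous.
apply: filterS (filterI Ux nV) => y [Uy Vy].
by apply: UV => //; rewrite rngV.
Qed.

Lemma src_continuous : continuous (sc : G -> G).
Proof.
move=> x W; rewrite -rngV => Wx.
have n : nbhs x (inv @^-1` (rg @^-1` W)) by exact/gpd_inv_continuous/rng_continuous.
by apply: filterS n => y; rewrite /= rngV.
Qed.

Lemma open_preimage_rng (U : set G) : open U -> open (rg @^-1` U).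
Proof. by move=> oU; apply: open_comp => // x _; exact: rng_continuous. Qed.

Lemma open_preimage_src (U : set G) : open U -> open (sc @^-1` U).
Proof. by move=> oU; apply: open_comp => // x _; exact: src_continuous. Qed.

Lemma open_preimage_inv (U : set G) : open U -> open (inv @^-1` U).
Proof. by move=> oU; apply: open_comp => // x _; exact: gpd_inv_continuous. Qed.

Lemma closed_unit_space : hausdorff_space G -> closed (unit_space G).
Proof.
move=> hG; rewrite (_ : unit_space G = [set x | rg x = x]).
  by apply: closed_equalizer => //; [exact: rng_continuous|move=> x; exact: cvg_id].
by apply/seteqP; split=> x /unit_spaceP.
Qed.

(** Continuity of the inverses of [r|_B] and [s|_B] is not recorded: [r] is an
    open map when [G] is ample. *)
Definition slice B : Prop :=
  [/\ compact B, open B, set_inj B (@gpd_rng G) & set_inj B (@gpd_src G)].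

Section ample.
Context (ampleG : ample G).

Lemma open_bisection_inj B : open_bisection B ->
  set_inj B (@gpd_rng G) /\ set_inj B (@gpd_src G).
Proof.
move=> [_ [V _ [_ _ [g [gK _]]]] [V' _ [_ _ [g' [g'K _]]]]]; split.
- by move=> x y /set_mem Bx /set_mem By e; rewrite -(gK x Bx) e gK.
- by move=> x y /set_mem Bx /set_mem By e; rewrite -(g'K x Bx) e g'K.
Qed.

Lemma ex_slice x (U : set G) : nbhs x U -> exists B, [/\ slice B, B x & B `<=` U].
Proof.
case: ampleG => bO /(_ x) /[apply] -[B [[cB oB] Bx] BU]; exists B; split => //.
by have [ir ic] := open_bisection_inj oB; split => //; case: oB.
Qed.

(** If [y] is close to a unit in a slice [B], then [y] and [rg y] both lie in [B]; having the same
    range, they coincide. *)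
Lemma open_unit_space : open (unit_space G).
Proof.
apply: open_nbhsP => x ux.
have [B [[_ oB ir _] Bx _]] := ex_slice (@filterT _ (nbhs x) _).
have nB : nbhs x B by exact: open_nbhs_nbhs.
have nr : nbhs x (rg @^-1` B) by apply: rng_continuous; rewrite unit_rngE.
apply: filterS (filterI nB nr) => y [By rBy]; apply/unit_spaceP.
by apply: ir; rewrite ?inE// rng_rng.
Qed.

Lemma open_relatively_open (U : set G) : relatively_open (unit_space G) U -> open U.
Proof.
move=> [UG /open_subspaceP[V oV VE]].
rewrite -(setIidl UG) -VE; apply: openI => //; exact: open_unit_space.
Qed.

(** The range of a bisection is relatively open among the units, which are themselves open in
    [G]. *)
Lemma open_image_rng (U : set G) : open U -> open (rg @` U).
Proof.
move=> oU; apply: open_nbhsP => _ [x Ux <-].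
case: ampleG => bO /(_ x U (open_nbhs_nbhs (conj oU Ux)))
  [B /= [[_ [_ [V rV [_ BV _]] _]] Bx] BU].
apply: (@filterS _ (nbhs (rg x)) _ V).
  by rewrite -BV; exact: image_subset.
by apply: open_nbhs_nbhs; split; [exact: open_relatively_open|rewrite -BV; exists x].
Qed.

Lemma ex_unit_slice u (U : set G) : unit_space G u -> nbhs u U ->
  exists K, [/\ compact K, open K, K `<=` unit_space G, K u & K `<=` U].
Proof.
move=> uu Uu.
have nu : nbhs u (unit_space G).
  by apply: open_nbhs_nbhs; split=> //; exact: open_unit_space.
have [K [[cK oK _ _] Ku KU]] := ex_slice (filterI nu Uu).
by exists K; split=> // x /KU[].
Qed.

Lemma compact_image_rng K : compact K -> compact (rg @` K).
Proof. by apply: continuous_compact; exact/continuous_subspaceT/rng_continuous. Qed.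

Lemma sliceV B : slice B -> slice (inv @^-1` B).
Proof.
move=> [cB oB ir ic]; split; [|exact: open_preimage_inv| |].
- rewrite (_ : _ @^-1` _ = inv @` B).
    by apply: continuous_compact => //; exact/continuous_subspaceT/gpd_inv_continuous.
  apply/seteqP; split=> [x Bx|_ [x Bx <-]]; first by exists (inv x); rewrite ?gpd_invK.
  by rewrite /preimage /= gpd_invK.
- move=> x y; rewrite !inE => Bx By e; rewrite -(gpd_invK x) -(gpd_invK y).
  by congr inv; apply: ic; rewrite ?inE// !srcV.
- move=> x y; rewrite !inE => Bx By e; rewrite -(gpd_invK x) -(gpd_invK y).
  by congr inv; apply: ir; rewrite ?inE// !rngV.
Qed.

End ample.
End topological_groupoid.

(** * Indicator functions and finitely supported sums *)

Lemma indic_in {R : pzRingType} {T : Type} {A : set T} {x : T} :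
  A x -> \1_A x = 1 :> R.
Proof. by move=> Ax; rewrite indicE mem_set. Qed.

Lemma indic_out {R : pzRingType} {T : Type} {A : set T} {x : T} :
  ~ A x -> \1_A x = 0 :> R.
Proof. by move=> Ax; rewrite indicE memNset. Qed.

Lemma indic_neq0 {R : pzRingType} {T : Type} {A : set T} {x : T} : \1_A x != 0 :> R -> A x.
Proof. by apply: contra_neqP; exact: indic_out. Qed.

Section finitely_supported_sums.
Context {R : nmodType} {T : choiceType}.
Implicit Types (P S : set T) (F : T -> R).

Lemma fsbig_single P F x : P x -> (forall y, P y -> y <> x -> F y = 0) ->
  \sum_(y \in P) F y = F x.
Proof.
move=> Px F0; rewrite -(fsbig_set1 +%R x F); apply/esym/fsbig_widen => [_ ->//|y [Py yx]].
exact: F0.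
Qed.

(** Range fibres of [G] may be infinite, so additivity is obtained by first restricting all three
    sums to a finite set carrying both summands. *)
Lemma fsbig_splitS S P F F' : finite_set (P `&` S) ->
  (forall x, P x -> ~ S x -> F x = 0) -> (forall x, P x -> ~ S x -> F' x = 0) ->
  \sum_(x \in P) (F x + F' x) = \sum_(x \in P) F x + \sum_(x \in P) F' x.
Proof.
move=> fS F0 F'0.
have w (H : T -> R) : (forall x, P x -> ~ S x -> H x = 0) ->
    \sum_(x \in P) H x = \sum_(x \in P `&` S) H x.
  move=> H0; apply/esym/fsbig_widen => [x []//|x [Px nPS]]; apply: H0 => // Sx.
  exact: nPS.
rewrite (w F)// (w F')// w ?fsbig_split// => x Px nS.
by rewrite F0// F'0// addr0.
Qed.

End finitely_supported_sums.

(** * Convolution with indicators *)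

Section steinberg_algebra.
Context {R : comNzRingType} {G : topologicalGroupoidType}.
Implicit Types (x y z a b : G) (A B K : set G) (f g : G -> R).
Local Notation "x ** y" := (gpd_mul x y) (at level 40, left associativity).
Local Notation inv := gpd_inv.
Local Notation rg := (@gpd_rng _).
Local Notation sc := (@gpd_src _).

Lemma convolution_single f g a b : rg b = rg a ->
  (forall y, rg y = rg a -> y <> b -> f y * g (inv y ** a) = 0) ->
  convolution f g a = f b * g (inv b ** a).
Proof. by move=> ba h; apply: fsbig_single. Qed.

Lemma convolution_eq0 f g a :
  (forall b, rg b = rg a -> f b * g (inv b ** a) = 0) -> convolution f g a = 0.
Proof. by move=> h; apply: fsbig1. Qed.

(** A slice meets each range fibre at most once, so one term survives and convolution becomes a
    scaled translation. *)
Lemma convolution_slicel (c : R) B g a b : set_inj B rg -> B b -> rg b = rg a ->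
  convolution (fun x => c * \1_B x) g a = c * g (inv b ** a).
Proof.
move=> iB Bb ba; rewrite (convolution_single ba) ?indic_in ?mulr1// => y ya yb.
by rewrite (indic_out (A := B)) ?mulr0 ?mul0r// => By; apply/yb/iB; rewrite ?inE// ya.
Qed.

Lemma convolution_slicel0 (c : R) B g a : ~ (rg @` B) (rg a) ->
  convolution (fun x => c * \1_B x) g a = 0.
Proof.
move=> nB; apply: convolution_eq0 => b ba.
by rewrite (indic_out (A := B)) ?mulr0 ?mul0r// => Bb; apply: nB; exists b.
Qed.

(** The surviving index [y] is the one with [inv y ** a = b], namely [a ** inv b]. *)
Lemma convolution_slicer (c : R) B f a b : set_inj B sc -> B b -> sc b = sc a ->
  convolution f (fun x => c * \1_B x) a = f (a ** inv b) * c.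
Proof.
move=> iB Bb ba.
have abV : sc a = rg (inv b) by rewrite rngV.
rewrite (@convolution_single _ _ _ (a ** inv b)) ?rngM//.
  rewrite gpd_invM// gpd_invK -gpd_assoc ?srcV ?rngV//.
  by rewrite -[inv a ** a]/(sc a) -ba mul_src indic_in ?mulr1.
move=> y ya yb; rewrite (indic_out (A := B)) ?mulr0// => By; apply: yb.
have -> : b = inv y ** a by apply: iB; rewrite ?inE// srcM ?srcV.
by rewrite gpd_invM ?srcV// gpd_invK gpd_mulVK.
Qed.

Lemma convolution_slicer0 (c : R) B f a : ~ (sc @` B) (sc a) ->
  convolution f (fun x => c * \1_B x) a = 0.
Proof.
move=> nB; apply: convolution_eq0 => b ba.
rewrite (indic_out (A := B)) ?mulr0// => Bb; apply: nB.
by exists (inv b ** a); rewrite ?srcM ?srcV.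
Qed.

Lemma convolution_unitl K f a : K `<=` unit_space G ->
  convolution \1_K f a = \1_K (rg a) * f a.
Proof.
move=> KG.
rewrite (@convolution_single _ _ _ (rg a)) ?rng_rng ?inv_rng ?rng_mul// => y ya ny.
rewrite indic_out ?mul0r// => Ky; apply: ny.
by rewrite -ya unit_rngE//; exact: KG.
Qed.

Lemma convolution_unitr K f a : K `<=` unit_space G ->
  convolution f \1_K a = f a * \1_K (sc a).
Proof.
move=> KG; rewrite (@convolution_single _ _ _ a)// => y ya ny.
rewrite indic_out ?mulr0// => Ky; apply: ny.
(* A unit of the form [inv y ** a] must be [sc y], whence [a = y ** sc y = y]. *)
have := mul_src y; rewrite -(gpd_mulVK ya).
have -> : inv y ** a = sc y; last by rewrite mul_src.
by rewrite -(unit_rngE (KG _ Ky)) rngM ?srcV// rngV.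
Qed.

(** * The Steinberg algebra: spanning by slices, closure under convolution *)

Lemma locally_constant_open f (S : set R) : locally_constant f -> open (f @^-1` S).
Proof.
move=> lf; apply: open_nbhsP => x Sfx; apply: filterS (lf x) => y fyx.
by rewrite /preimage /= fyx.
Qed.

Lemma locally_constant_clopen f (S : set R) : locally_constant f -> clopen (f @^-1` S).
Proof.
move=> lf; split; first exact: locally_constant_open.
by rewrite -openC preimage_setC; exact: locally_constant_open.
Qed.

Lemma locally_constantM f g : locally_constant f -> locally_constant g ->
  locally_constant (fun x => f x * g x).
Proof. by move=> lf lg x; apply: filterS (filterI (lf x) (lg x)) => y [-> ->]. Qed.

Lemma locally_constant_cst (c : R) : locally_constant (fun _ : G => c).
Proof. by move=> x; exact: filterE. Qed.

Lemma locally_constant_indic A : clopen A -> locally_constant (\1_A : G -> R).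
Proof.
move=> [oA cA] x; have [Ax|nAx] := pselect (A x).
  apply: (@filterS _ (nbhs x) _ A) => [y Ay|]; first by rewrite !indic_in.
  exact: open_nbhs_nbhs.
apply: (@filterS _ (nbhs x) _ (~` A)) => [y nAy|]; first by rewrite !indic_out.
by apply: open_nbhs_nbhs; split=> //; rewrite openC.
Qed.

(** Local constancy makes the set where [f] is nonzero clopen, hence equal to its closure. *)
Lemma steinberg_compact f : steinberg R G f -> compact [set x | f x != 0].
Proof.
move=> [lf cf]; have [_ cl] := locally_constant_clopen [set r | r != 0] lf.
by move/closure_id: cl; rewrite /preimage /= => ->.
Qed.

Section hausdorff.
Context (hausdorffG : hausdorff_space G).

Lemma clopen_compact K : compact K -> open K -> clopen K.
Proof. by split=> //; exact: compact_closed. Qed.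

Lemma steinbergP f K : locally_constant f -> compact K ->
  (forall x, f x != 0 -> K x) -> steinberg R G f.
Proof.
move=> lf cK fK; split=> //; apply: (subclosed_compact _ cK); first exact: closed_closure.
rewrite (iffLR (closure_id _) (compact_closed hausdorffG cK)); exact: closureS.
Qed.

Lemma steinberg0 : steinberg R G 0.
Proof.
apply: (@steinbergP _ set0); [exact: locally_constant_cst|exact: compact0|].
by move=> x; rewrite eqxx.
Qed.

Lemma steinberg_indic (c : R) K : compact K -> open K ->
  steinberg R G (fun x => c * \1_K x).
Proof.
move=> cK oK; apply: (steinbergP _ cK).
  apply: locally_constantM; first exact: locally_constant_cst.
  exact/locally_constant_indic/clopen_compact.
by move=> x; apply: contra_neqP => /indic_out ->; rewrite mulr0.
Qed.

Lemma steinberg_indic1 K : compact K -> open K -> steinberg R G \1_K.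
Proof.
move=> cK oK; have := steinberg_indic 1 cK oK.
by congr (steinberg R G); apply/funext => x; rewrite mul1r.
Qed.

Lemma steinbergB f g : steinberg R G f -> steinberg R G g -> steinberg R G (f - g).
Proof.
move=> sf sg.
apply: (steinbergP _ (compactU (steinberg_compact sf) (steinberg_compact sg))).
  case: sf sg => lf _ [lg _] x.
  by apply: filterS (filterI (lf x) (lg x)) => y [fy gy]; rewrite !fctE fy gy.
move=> x; apply: contra_neqP => /not_orP[/= /negP + /negP].
by rewrite !negbK !fctE => /eqP-> /eqP->; rewrite subr0.
Qed.

Lemma steinbergD f g : steinberg R G f -> steinberg R G g -> steinberg R G (f + g).
Proof.
move=> sf sg; rewrite -[g]opprK -(sub0r g).
by apply: steinbergB => //; apply: steinbergB => //; exact: steinberg0.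
Qed.

Lemma steinberg_restrict f A : steinberg R G f -> clopen A ->
  steinberg R G (fun x => f x * \1_A x).
Proof.
move=> sf cA; apply: (steinbergP _ (steinberg_compact sf)).
  by case: sf => lf _; apply: locally_constantM => //; exact: locally_constant_indic.
by move=> x /=; apply: contra_neq => ->; rewrite mul0r.
Qed.

Context (ampleG : ample G).

(** Multiples of indicators of slices span the algebra: the support has a finite cover by slices on
    which [f] is constant, and this cover can be made disjoint. *)
Lemma steinberg_ind (P : (G -> R) -> Prop) :
  P 0 ->
  (forall f g, steinberg R G f -> steinberg R G g -> P f -> P g -> P (f + g)) ->
  (forall c B, slice B -> P (fun x => c * \1_B x)) ->
  forall f, steinberg R G f -> P f.
Proof.
move=> P0 PD Pi f sf.
(* Quantifying over every clopen [D] makes [Q] stable under unions: the part of [C'] already covered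
   by [C] is cut away by shrinking [D]. *)
pose Q A := exists C, [/\ clopen C, A `<=` C &
  forall D, clopen D -> P (fun x => f x * \1_(C `&` D) x)].
have QT : Q [set x | f x != 0].
  apply: compact_ind (steinberg_compact sf) _ => [|A A'|A A' AA'|x _].
  - exists set0; split=> //; [exact: clopen0|move=> D _].
    rewrite (_ : (fun _ => _) = 0)//; apply/funext => x.
    by rewrite set0I indic0 mulr0.
  - move=> [C [cC AC PC]] [C' [cC' AC' PC']]; exists (C `|` C'); split.
    + exact: clopenU.
    + exact: setUSS.
    + move=> D cD; rewrite (_ : (fun _ => _) =
        (fun x => f x * \1_(C `&` D) x) +
        (fun x => f x * \1_(C' `&` (D `&` ~` C)) x)).
        have cDC : clopen (D `&` ~` C) by apply: clopenI => //; exact: clopenC.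
        by apply: PD; [exact/steinberg_restrict/clopenI|exact/steinberg_restrict/clopenI
          |exact: PC|exact: PC'].
      apply/funext => x; rewrite fctE -mulrDr; congr (_ * _).
      rewrite !indicE !in_setI in_setU in_setC.
      by case: (x \in C); case: (x \in C'); case: (x \in D); rewrite /= ?addr0 ?add0r.
  - by move=> [C [cC AC PC]]; exists C; split=> // y /AA' /AC.
  - case: (sf) => lf _; have [B [sB Bx BU]] := ex_slice ampleG (lf x).
    exists B; first by apply: open_nbhs_nbhs; split=> //; case: sB.
    case: (sB) => cB oB irB isB.
    exists B; split=> //; [exact: clopen_compact|move=> D cD].
    rewrite (_ : (fun _ => _) = (fun y => f x * \1_(B `&` D) y)); last first.
      apply/funext => y; have [[By _]|nBy] := pselect ((B `&` D) y).
        by rewrite (BU y By).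
      by rewrite indic_out// !mulr0.
    apply: Pi; split.
    + apply: (subclosed_compact _ cB) => //.
      by apply: closedI; [exact: compact_closed|case: cD].
    + by apply: openI => //; case: cD.
    + by move=> y z; rewrite !inE => -[By _] [Bz _]; apply: irB; rewrite inE.
    + by move=> y z; rewrite !inE => -[By _] [Bz _]; apply: isB; rewrite inE.
have [C [_ AC /(_ setT clopenT)]] := QT.
rewrite setIT; congr P; apply/funext => x.
have [->|/AC Cx] := eqVneq (f x) 0; first by rewrite mul0r.
by rewrite indic_in// mulr1.
Qed.

(** Finitely many slices cover the support, and each has at most one point of range [v]. *)
Lemma steinberg_finite_fiber f (v : G) : steinberg R G f ->
  finite_set ([set b | rg b = v] `&` [set b | f b != 0]).
Proof.
move=> sf; apply: (@compact_ind _ (fun A => finite_set ([set b | rg b = v] `&` A)))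
  (steinberg_compact sf) _.
- by rewrite setI0.
- by move=> A B fA fB; rewrite setIUr finite_setU.
- by move=> A B AB; apply: sub_finite_set; exact: setIS.
- move=> x _; have [B [[_ oB irB _] Bx _]] := ex_slice ampleG (@filterT _ (nbhs x) _).
  exists B; first exact: open_nbhs_nbhs.
  have [[b [bv Bb]]|/set0P/negP/negPn/eqP->//] :=
    pselect (([set b | rg b = v] `&` B) !=set0).
  apply: (@sub_finite_set _ _ [set b]) => // y [/= yv By].
  by apply: irB; rewrite ?inE// yv bv.
Qed.

Lemma convolution_addl f f' g : steinberg R G f -> steinberg R G f' ->
  convolution (f + f') g = convolution f g + convolution f' g.
Proof.
move=> sf sf'; apply/funext => a.
rewrite -[RHS]/(convolution f g a + convolution f' g a) /convolution.
under eq_fsbigr do rewrite fctE mulrDl.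
apply: (@fsbig_splitS _ _ ([set b | f b != 0] `|` [set b | f' b != 0])).
- by rewrite setIUr finite_setU; split; exact: steinberg_finite_fiber.
- by move=> b _ /not_orP[/negP/negPn/eqP-> _]; rewrite mul0r.
- by move=> b _ /not_orP[_ /negP/negPn/eqP->]; rewrite mul0r.
Qed.

Lemma convolution_addr f g g' : steinberg R G f ->
  convolution f (g + g') = convolution f g + convolution f g'.
Proof.
move=> sf; apply/funext => a.
rewrite -[RHS]/(convolution f g a + convolution f g' a) /convolution.
under eq_fsbigr do rewrite fctE mulrDr.
apply: (@fsbig_splitS _ _ [set b | f b != 0]).
- exact: steinberg_finite_fiber.
- by move=> b _ /negP/negPn/eqP->; rewrite mul0r.
- by move=> b _ /negP/negPn/eqP->; rewrite mul0r.
Qed.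

Lemma convolution0l g : convolution (0 : G -> R) g = 0.
Proof. by apply/funext => a; apply: convolution_eq0 => b _; rewrite mul0r. Qed.

Lemma convolution0r f : convolution f (0 : G -> R) = 0.
Proof. by apply/funext => a; apply: convolution_eq0 => b _; rewrite mulr0. Qed.

(** Composability is a closed condition in a Hausdorff groupoid. Such product sets will contain the
    supports of convolutions. *)
Lemma compact_composable_mul A B : compact A -> compact B ->
  compact ((fun p : G * G => p.1 ** p.2) @` ((A `*` B) `&` composable_pairs G)).
Proof.
move=> cA cB; apply: continuous_compact.
  by apply: continuous_subspaceW (@gpd_mul_continuous G); exact: subIsetr.
apply: compact_closedI; first exact: compact_setX.
apply: closed_equalizer => // p.
- by apply: (@continuous_comp _ _ _ fst); [exact: cvg_fst|exact: src_continuous].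
- by apply: (@continuous_comp _ _ _ snd); [exact: cvg_snd|exact: rng_continuous].
Qed.

(** By additivity in [f] it suffices to treat a slice [B]. The value at [a] is then zero or
    [c * g (inv b ** a)], with [b] the point of [B] above [rg a]. *)
Lemma steinberg_convolution f g : steinberg R G f -> steinberg R G g ->
  steinberg R G (convolution f g).
Proof.
move=> sf sg; move: f sf; apply: steinberg_ind.
- by rewrite convolution0l; exact: steinberg0.
- by move=> f f' sf sf' sfg sf'g; rewrite convolution_addl//; exact: steinbergD.
move=> c B [cB oB irB _].
apply: (steinbergP _ (compact_composable_mul cB (steinberg_compact sg))).
- move=> a; have [[b Bb ba]|nBa] := pselect ((rg @` B) (rg a)); last first.
    have oC : open (~` (rg @` B)).
      by rewrite openC; apply: compact_closed => //; exact: compact_image_rng.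
    have : nbhs a (rg @^-1` (~` (rg @` B))).
      by apply: open_nbhs_nbhs; split=> //; exact: open_preimage_rng.
    by apply: filterS => a' nBa'; rewrite !convolution_slicel0.
  have bVa : sc (inv b) = rg a by rewrite srcV.
  have [lg _] := sg.
  have [U [V [Ub Va UV]]] := nbhs_mul bVa (lg (inv b ** a)).
  have : nbhs b (inv @^-1` U) by exact: gpd_inv_continuous.
  rewrite nbhsE => -[N [oN Nb] NU].
  (* As [rg] is open, for [a'] near [a] the corresponding point [b'] of [B] is near [b]; so
     [inv b' ** a'] stays where [g] is constant. *)
  have nO : nbhs a (rg @^-1` (rg @` (B `&` N))).
    apply: open_nbhs_nbhs; split; last by exists b.
    by apply/open_preimage_rng/open_image_rng => //; exact: openI.
  apply: filterS (filterI Va nO) => a' [Va' [b' [Bb' Nb'] ba']].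
  rewrite (convolution_slicel _ _ irB Bb' ba') (convolution_slicel _ _ irB Bb ba).
  by congr (_ * _); apply: UV => //; [exact: NU|rewrite srcV].
- move=> a; have [[b Bb ba]|nBa] := pselect ((rg @` B) (rg a)); last first.
    by rewrite convolution_slicel0// eqxx.
  rewrite (convolution_slicel _ _ irB Bb ba) => ga.
  exists (b, inv b ** a) => /=; last by rewrite gpd_mulVK.
  split; last by rewrite /composable_pairs /= rngM ?srcV// rngV.
  by split=> //=; apply: contra_neq ga => ->; rewrite mulr0.
Qed.

End hausdorff.
End steinberg_algebra.

(** * Nonzero basic ideals of effective and minimal groupoids *)

Section basic_simplicity.
Context {R : comNzRingType} {G : topologicalGroupoidType}.
Context (hausdorffG : hausdorff_space G) (ampleG : ample G).
Implicit Types (x y z a b u v : G) (A B K U V : set G) (f g : G -> R).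
Local Notation "x ** y" := (gpd_mul x y) (at level 40, left associativity).
Local Notation inv := gpd_inv.
Local Notation rg := (@gpd_rng _).
Local Notation sc := (@gpd_src _).

(** Effectiveness provides a point of [A] over [U] whose source and range differ,
    hence have disjoint neighbourhoods; compactness reduces [A] to one slice. *)
Lemma effective_separation A U : effective G -> compact A ->
  A `<=` ~` unit_space G -> open U -> U !=set0 ->
  exists V, [/\ open V, V !=set0, V `<=` U &
    forall a, A a -> V (rg a) -> ~ V (sc a)].
Proof.
move=> effG cA AG; move: U.
pose P A := forall U, open U -> U !=set0 -> exists V, [/\ open V, V !=set0, V `<=` U &
  forall a, A a -> V (rg a) -> ~ V (sc a)].
apply: (@compact_ind _ P) cA _ => [U oU U0|B C PB PC U oU U0|B C BC PC U oU U0|x Ax].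
- by exists U; split=> // a [].
- have [V [oV V0 VU VB]] := PB U oU U0.
  have [W [oW W0 WV WC]] := PC V oV V0.
  exists W; split=> // [y /WV /VU //|a [Ba|Ca]]; last exact: WC.
  by move=> /WV Va /WV; exact: VB.
- have [V [oV V0 VU VC]] := PC U oU U0.
  by exists V; split=> // a /BC; exact: VC.
have nx : nbhs x (~` unit_space G).
  by apply: open_nbhs_nbhs; split; [rewrite openC; exact: closed_unit_space|exact: AG].
have [B [[_ oB irB _] Bx BG]] := ex_slice ampleG nx.
exists B; first exact: open_nbhs_nbhs.
move=> U oU U0.
have [[b [Bb Ub]]|nBU] := pselect (exists b, B b /\ U (rg b)); last first.
  by exists U; split=> // a Ba Ua; case: nBU; exists a.
have [b' [[Bb' Ub'] nb']] : exists b', (B `&` rg @^-1` U) b' /\ sc b' <> rg b'.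
  apply: contrapT => h.
  have : interior (isotropy G `\` unit_space G) b; last by rewrite effG.
  apply: (@filterS _ (nbhs b) _ (B `&` rg @^-1` U)); last first.
    by apply: open_nbhs_nbhs; split=> //; apply: openI => //; exact: open_preimage_rng.
  move=> y [By Uy]; split; last exact: BG.
  by apply: contrapT => ny; apply: h; exists y.
move: (hausdorffG); rewrite open_hausdorff => /(_ (rg b') (sc b')).
case; first by apply/eqP => e; apply: nb'.
move=> [V W] /= [/set_mem Vb' /set_mem Wb'] [oV oW /eqP VW].
(* By injectivity of [rg] on [B], a point of [B] with range in this set has its source in [W], hence
   outside [V]. *)
exists (U `&` V `&` (rg @` (B `&` sc @^-1` W))); split.
- apply: openI; first exact: openI.
  by apply: open_image_rng => //; apply: openI => //; exact: open_preimage_src.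
- by exists (rg b'); split=> //; exists b'.
- by move=> y [[]].
- move=> a Ba [_ [a' [Ba' Wa'] aa']] [[_ Va] _].
  have {}aa' : a' = a by apply: irB; rewrite ?inE.
  by have : (V `&` W) (sc a) by [split=> //; rewrite -aa']; rewrite VW.
Qed.

Lemma ideal_unit_indic (I : set (G -> R)) f : effective G -> basic_ideal I ->
  I f -> f <> 0 ->
  exists K, [/\ compact K, open K, K `<=` unit_space G, K !=set0 & I \1_K].
Proof.
move=> effG [[IA _ _ Il Ir] bI] If f0.
have [x fx] : exists x, f x != 0.
  apply: contrapT => h; apply: f0; apply/funext => x; apply/eqP/negPn/negP => fx.
  by apply: h; exists x.
have [B [sB Bx _]] := ex_slice ampleG (@filterT _ (nbhs x) _).
have [cB' oB' _ isB'] := sliceV sB.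
(* Translating by [inv x] carries the value of [f] at [x] to the unit [rg x]. *)
pose g := convolution f (fun y => 1 * \1_(inv @^-1` B) y).
have Ig : I g by apply: Ir => //; exact: steinberg_indic.
have gx : g (rg x) = f x.
  rewrite /g (@convolution_slicer _ _ _ _ _ _ (inv x)) ?srcV ?src_rng//.
    by rewrite gpd_invK rng_mul mulr1.
  by rewrite /preimage /= gpd_invK.
have sg : steinberg R G g by exact: IA.
have [lg _] := sg.
pose D := [set y | g y != 0] `&` ~` unit_space G.
have cD : compact D.
  apply: compact_closedI; first exact: steinberg_compact.
  by apply: open_closedC; exact: open_unit_space.
(* Separation is applied among the units where [g] equals [f x], so that cutting [g] down by [\1_K]
   on both sides leaves [f x] times [\1_K]. *)
have [V [oV [v Vv] VU VD]] : exists V, [/\ open V, V !=set0,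
    V `<=` (g @^-1` [set f x]) `&` unit_space G &
    forall a, D a -> V (rg a) -> ~ V (sc a)].
  apply: effective_separation => //.
  - by move=> y [].
  - by apply: openI; [exact: locally_constant_open|exact: open_unit_space].
  - by exists (rg x); split=> //; exact: unit_rng.
have [_ uv] := VU _ Vv.
have [K [cK oK KG Kv KV]] := ex_unit_slice ampleG uv (open_nbhs_nbhs (conj oV Vv)).
exists K; split=> //; first by exists v.
apply: (bI (f x)) => //.
(* A point of [D] with range in [K] has its source outside [K]. *)
have -> : (fun y => f x * \1_K y) = convolution (convolution \1_K g) \1_K.
  apply/funext => a; rewrite convolution_unitr// convolution_unitl//.
  have [ua|nua] := pselect (unit_space G a).
    rewrite unit_rngE// unit_srcE//.
    have [Ka|nKa] := pselect (K a); last by rewrite !(indic_out nKa) !mulr0.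
    by rewrite !(indic_in Ka) mul1r !mulr1; have [-> _] := VU _ (KV _ Ka).
  rewrite [\1_K a]indic_out ?mulr0; last by move=> /KG.
  have [->|ga] := eqVneq (g a) 0; first by rewrite mulr0 mul0r.
  have [Kra|nKra] := pselect (K (rg a)); last by rewrite indic_out// !mul0r.
  rewrite [\1_K (sc a)]indic_out ?mulr0// => /KV; apply: VD; [by []|exact: KV].
by apply: Ir; [exact: steinberg_indic1|apply: Il => //; exact: steinberg_indic1].
Qed.

(** Inclusion-exclusion: on indicators of units convolution is the pointwise product. It is written
    with subtractions, the additive operation given by [two_sided_ideal]. *)
Lemma ideal_indicU (I : set (G -> R)) K K' : two_sided_ideal I ->
  compact K -> open K -> K `<=` unit_space G -> K' `<=` unit_space G ->
  I \1_K -> I \1_K' -> I \1_(K `|` K').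
Proof.
move=> [IA _ IB Il _] cK oK KG KG' IK IK'.
have -> : \1_(K `|` K') = \1_K - (convolution \1_K \1_K' - \1_K') :> (G -> R).
  apply/funext => a; rewrite -[RHS]/(\1_K a - (convolution \1_K \1_K' a - \1_K' a)).
  rewrite convolution_unitl//.
  have -> : \1_K (rg a) * \1_K' a = \1_K a * \1_K' a :> R.
    have [K'a|nK'a] := pselect (K' a); first by rewrite unit_rngE//; exact: KG'.
    by rewrite (indic_out nK'a) !mulr0.
  rewrite !indicE in_setU; case: (a \in K); case: (a \in K') => /=;
    by rewrite ?mul1r ?mulr0 ?mul0r ?subrr ?sub0r ?oppr0 ?opprK ?subr0 ?addr0.
apply: (IB) => //; apply: (IB) => //.
by apply: Il => //; exact: steinberg_indic1.
Qed.

Lemma minimal_ideal_full (I : set (G -> R)) K : minimal G -> two_sided_ideal I ->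
  compact K -> open K -> K `<=` unit_space G -> K !=set0 -> I \1_K ->
  I = steinberg R G.
Proof.
move=> minG idI cK oK KG [k Kk] IK; have [IA I0 IB Il Ir] := idI.
(* This union of all sets [L] with [\1_L] in the ideal is open and, as shown next, invariant;
   minimality makes it the whole unit space. *)
pose U := [set u | exists L, [/\ compact L, open L, L `<=` unit_space G, L u & I \1_L]].
have oU : open U.
  apply: open_nbhsP => u [L [cL oL LG Lu IL]].
  apply: (@filterS _ (nbhs u) _ L); last exact: open_nbhs_nbhs.
  by move=> y Ly; exists L.
have UG : U `<=` unit_space G by move=> u [L [_ _ LG Lu _]]; exact: LG.
have invU : invariant_set U.
  apply/seteqP; split=> [_ [x [L [cL oL LG Lx IL]] <-]|u Uu]; last first.
    by exists u; rewrite ?unit_rngE /preimage/= ?unit_srcE//; exact: UG.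
  have nx : nbhs x (sc @^-1` L).
    by apply: open_nbhs_nbhs; split=> //; exact: open_preimage_src.
  have [B [sB Bx BL]] := ex_slice ampleG nx.
  have [cB oB irB isB] := sB.
  have [cB' oB' irB' isB'] := sliceV sB.
  exists (rg @` B); split; [exact: compact_image_rng|exact: open_image_rng| |by exists x|].
    by move=> _ [y _ <-]; exact: unit_rng.
  (* The sources of [B] lie in [L], so [\1_L] is a right unit for [\1_B]; convolving with the
     inverse slice then gives the indicator of the range of [B]. *)
  have IB1 : I (fun y => 1 * \1_B y).
    have -> : (fun y => 1 * \1_B y) = convolution (fun y => 1 * \1_B y) \1_L :> (G -> R).
      apply/funext => a; rewrite convolution_unitr//.
      have [Ba|nBa] := pselect (B a); last by rewrite indic_out// mulr0 mul0r.
      by rewrite [\1_L _]indic_in ?mulr1//; exact: BL.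
    by apply: Il => //; exact: steinberg_indic.
  have -> : \1_(rg @` B) = convolution (fun y => 1 * \1_B y)
      (fun y => 1 * \1_(inv @^-1` B) y) :> (G -> R).
    apply/funext => a; have [[b Bb ba]|nBa] := pselect ((rg @` B) (rg a)); last first.
      rewrite convolution_slicel0// indic_out// => -[b Bb ba].
      by apply: nBa; exists b; rewrite // -ba rng_rng.
    rewrite (convolution_slicel _ _ irB Bb ba) !mul1r !indicE; congr (_%:R).
    congr (nat_of_bool _); apply/idP/idP; rewrite !inE.
      move=> [b' Bb' b'a].
      have bb' : b' = b by apply: irB; rewrite ?inE// ba -b'a rng_rng.
      rewrite /preimage /= gpd_invM ?srcV// gpd_invK -b'a inv_rng bb'.
      by rewrite rng_mul.
    (* Conversely, [inv a ** b] lies in [B] and has the source of [b], so it equals [b]; cancelling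
       [b] shows that [a] is the unit [rg b]. *)
    rewrite /preimage /= gpd_invM ?srcV// gpd_invK => Bab.
    have e : inv a ** b = b.
      by apply: isB; rewrite ?inE// srcM// srcV.
    have ab : sc (inv a) = rg b by rewrite srcV.
    exists b => //; rewrite -[RHS]gpd_invK -(gpd_mulK ab) e.
    by rewrite -/(rg b) inv_rng.
  by apply: Ir => //; exact: steinberg_indic.
have {}UE : U = unit_space G.
  have rU : relatively_open (unit_space G) U by split=> //; exact: open_subspaceW.
  have [U0|//] := minG U rU invU.
  have : U k by exists K.
  by rewrite U0.
apply/seteqP; split=> // f sf.
(* One [L] containing the ranges of the whole support makes [\1_L] a left unit for [f]. *)
have [L [cL oL LG fL IL]] : exists L, [/\ compact L, open L, L `<=` unit_space G,
    rg @` [set x | f x != 0] `<=` L & I \1_L].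
  pose P A := exists L, [/\ compact L, open L, L `<=` unit_space G, A `<=` L & I \1_L].
  apply: (@compact_ind _ P) (compact_image_rng (steinberg_compact sf)) _.
  - exists set0; split=> //; [exact: compact0|exact: open0|].
    by rewrite indic0.
  - move=> A B [L [cL oL LG AL IL]] [L' [cL' oL' LG' AL' IL']].
    exists (L `|` L'); split; [exact: compactU|exact: openU| | |exact: ideal_indicU].
      by move=> x [/LG|/LG'].
    exact: setUSS.
  - by move=> A B AB [L [cL oL LG BL IL]]; exists L; split=> // x /AB /BL.
  - move=> _ [x _ <-]; have : unit_space G (rg x) by exact: unit_rng.
    rewrite -UE => -[L [cL oL LG Lx IL]].
    exists L; first exact: open_nbhs_nbhs.
    by exists L; split.
have -> : f = convolution \1_L f.
  apply/funext => a; rewrite convolution_unitl//.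
  have [->|fa] := eqVneq (f a) 0; first by rewrite mulr0.
  by rewrite indic_in ?mul1r//; apply: fL; exists a.
exact: Ir.
Qed.

(** * Basic simplicity implies minimality *)

Lemma support_ideal U : invariant_set U ->
  two_sided_ideal [set f | steinberg R G f /\ forall x, f x != 0 -> U (sc x)].
Proof.
(* Left factors preserve the source and right factors the range, so the two conditions on [x] must
   be interchangeable. *)
move=> invU; have Usr x : U (sc x) -> U (rg x) by move=> Ux; rewrite -invU; exists x.
have Urs x : U (rg x) -> U (sc x) by rewrite -srcV -(rngV x); exact: Usr.
split.
- by move=> f [].
- by split; [exact: steinberg0|move=> x; rewrite eqxx].
- move=> f g [sf fU] [sg gU]; split; first exact: steinbergB.
  move=> x; have [f0|/fU//] := eqVneq (f x) 0; have [g0|/gU//] := eqVneq (g x) 0.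
  by rewrite -[(f - g) x]/(f x - g x) f0 g0 subr0 eqxx.
- move=> h f sh [sf fU]; split; first exact: steinberg_convolution.
  move=> x; apply: contra_neqP => nUx; apply: convolution_eq0 => b bx.
  have [->|/fU] := eqVneq (f (inv b ** x)) 0; first by rewrite mulr0.
  by rewrite srcM ?srcV.
- move=> h f sh [sf fU]; split; first exact: steinberg_convolution.
  move=> x; apply: contra_neqP => nUx; apply: convolution_eq0 => b bx.
  have [->|/fU/Usr] := eqVneq (f b) 0; first by rewrite mul0r.
  by rewrite bx => /Urs.
Qed.

(** For [r != 0] the support of [r * \1_K] is [K], so the support ideal of [U] is basic. Indicators
    of small sets of units show that it is zero only for empty [U], and everything only for the full
    unit space. *)
Lemma basically_simple_minimal : basically_simple R G -> minimal G.
Proof.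
move=> simpleG U rU invU; have [UG _] := rU.
have oU := open_relatively_open ampleG rU.
set I := [set f | steinberg R G f /\ forall x, f x != 0 -> U (sc x)].
have I1 (r : R) K : compact K -> open K -> K `<=` U -> r != 0 -> I (fun x => r * \1_K x).
  move=> cK oK KU r0; split; first exact: steinberg_indic.
  move=> x; apply: contra_neqP => nUx; rewrite indic_out ?mulr0// => /KU Ux.
  by apply: nUx; rewrite unit_srcE//; exact: UG.
have bI : basic_ideal I.
  split; first exact: support_ideal.
  move=> r K r0 cK oK KG [_ rK]; split; first exact: steinberg_indic1.
  move=> x /indic_neq0 Kx; apply: rK.
  by rewrite indic_in// mulr1.
have [I0|IA] := simpleG I bI; [left|right].
- apply/seteqP; split=> // u Uu.
  have [K [cK oK KG Ku KU]] :=
    ex_unit_slice ampleG (UG _ Uu) (open_nbhs_nbhs (conj oU Uu)).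
  have : I (fun x => 1 * \1_K x) by apply: I1 => //; exact: oner_neq0.
  rewrite I0 => /(congr1 (fun f => f u)) /= /eqP.
  by rewrite indic_in// mulr1 -[X in _ == X]/(0 : R) oner_eq0.
- apply/seteqP; split=> // u uu.
  have [K [cK oK KG Ku _]] := ex_unit_slice ampleG uu (@filterT _ (nbhs u) _).
  have : I \1_K by rewrite IA; exact: steinberg_indic1.
  by move=> [_ /(_ u)]; rewrite unit_srcE// indic_in// oner_eq0 => /(_ isT).
Qed.

(** * Basic simplicity implies effectiveness *)

(** The matrix entry at [(v, u)] of [f] acting on the free module over the unit
    space. *)
Definition hom_sum f u v : R := \sum_(x \in [set x | rg x = v /\ sc x = u]) f x.

Lemma hom_finite f u v : steinberg R G f ->
  finite_set ([set x | rg x = v /\ sc x = u] `&` [set x | f x != 0]).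
Proof.
move=> sf; apply: sub_finite_set (steinberg_finite_fiber ampleG v sf).
by move=> x [[xv _] fx].
Qed.

Lemma hom_sumD f g u v : steinberg R G f -> steinberg R G g ->
  hom_sum (f + g) u v = hom_sum f u v + hom_sum g u v.
Proof.
move=> sf sg; apply: (@fsbig_splitS _ _ ([set x | f x != 0] `|` [set x | g x != 0])).
- by rewrite setIUr finite_setU; split; exact: hom_finite.
- by move=> b _ /not_orP[/negP/negPn/eqP].
- by move=> b _ /not_orP[_ /negP/negPn/eqP].
Qed.

Lemma hom_sumB f g u v : steinberg R G f -> steinberg R G g ->
  hom_sum (f - g) u v = hom_sum f u v - hom_sum g u v.
Proof.
move=> sf sg; have := hom_sumD u v (steinbergB hausdorffG sf sg) sg.
by rewrite subrK => ->; rewrite addrK.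
Qed.

Lemma hom_sumZ (c : R) f u v : steinberg R G f ->
  hom_sum (fun x => c * f x) u v = c * hom_sum f u v.
Proof.
move=> sf; apply/esym/full_fsbig_distrr.
apply: sub_finite_set (hom_finite u v sf) => x [xuv /eqP fx].
by split.
Qed.

(** Left multiplication by [b] is a bijection from the arrows with range [sc b] and source [u] to
    those with range [rg b] and source [u]. *)
Lemma hom_sum_mull f b u : hom_sum (fun x => f (inv b ** x)) u (rg b) = hom_sum f u (sc b).
Proof.
rewrite /hom_sum (@reindex_fsbig _ _ _ _ _ (gpd_mul b)
  [set x | rg x = sc b /\ sc x = u]); last first.
  split.
  - by move=> x [xb xu] /=; rewrite rngM ?srcM.
  - move=> x y; rewrite !inE => -[xb xu] [yb yu] e.
    by rewrite -(@gpd_mulKV _ b x)// e gpd_mulKV.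
  - move=> x [xb xu]; exists (inv b ** x); last by rewrite gpd_mulVK.
    by rewrite /= rngM ?srcM ?srcV ?rngV.
by apply: eq_fsbigr => x; rewrite inE => -[xb xu]; rewrite gpd_mulKV.
Qed.

Lemma hom_sum_mulr f b v : hom_sum (fun x => f (x ** inv b)) (sc b) v = hom_sum f (rg b) v.
Proof.
rewrite /hom_sum (@reindex_fsbig _ _ _ _ _ (fun x => x ** b)
  [set x | rg x = v /\ sc x = rg b]); last first.
  split.
  - by move=> x [xb xu] /=; rewrite rngM ?srcM.
  - move=> x y; rewrite !inE => -[xb xu] [yb yu] e.
    by rewrite -(@gpd_mulK _ x b)// e gpd_mulK.
  - move=> x [xb xu]; have xbV : sc x = rg (inv b) by rewrite rngV.
    exists (x ** inv b); first by rewrite /= rngM ?srcM ?srcV.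
    by rewrite -{2}(gpd_invK b) gpd_mulK.
by apply: eq_fsbigr => x; rewrite inE => -[xb xu]; rewrite gpd_mulK.
Qed.

(** Absorption is checked on multiples of slice indicators: convolving with one turns each matrix
    entry into zero or [c] times another entry of [f]. *)
Lemma hom_sum_ideal :
  two_sided_ideal [set f | steinberg R G f /\ forall u v, hom_sum f u v = 0].
Proof.
split.
- by move=> f [].
- by split; [exact: steinberg0|move=> u v; exact: fsbig1].
- move=> f g [sf f0] [sg g0]; split=> [|u v]; first exact: steinbergB.
  by rewrite hom_sumB// f0 g0 subr0.
- move=> h f sh [sf f0]; split=> [|u v]; first exact: steinberg_convolution.
  move: h sh; apply: steinberg_ind => //.
  + by rewrite convolution0l; exact: fsbig1.
  + move=> h h' sh sh' h0 h'0; rewrite convolution_addl// hom_sumD ?h0 ?h'0 ?addr0//;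
      exact: steinberg_convolution.
  move=> c B [_ _ irB _].
  have [[b Bb bv]|nBv] := pselect ((rg @` B) v); last first.
    apply: fsbig1 => x [xv _]; apply: convolution_slicel0; by rewrite xv.
  rewrite -bv -[RHS](mulr0 c) -(f0 u (sc b)) -hom_sum_mull.
  rewrite -[in LHS]/(hom_sum _ u (rg b)).
  transitivity (hom_sum (fun x => c * f (inv b ** x)) u (rg b)).
    apply: eq_fsbigr => x; rewrite inE => -[xb xu].
    exact: convolution_slicel.
  by rewrite (hom_sum_mull (fun y => c * f y)) hom_sumZ// hom_sum_mull.
- move=> h f sh [sf f0]; split=> [|u v]; first exact: steinberg_convolution.
  move: h sh; apply: steinberg_ind => //.
  + by rewrite convolution0r; exact: fsbig1.
  + move=> h h' sh sh' h0 h'0; rewrite convolution_addr// hom_sumD ?h0 ?h'0 ?addr0//;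
      exact: steinberg_convolution.
  move=> c B [_ _ _ isB].
  have [[b Bb bu]|nBu] := pselect ((sc @` B) u); last first.
    by apply: fsbig1 => x [_ xu]; apply: convolution_slicer0; rewrite xu.
  transitivity (hom_sum (fun x => c * f (x ** inv b)) u v).
    apply: eq_fsbigr => x; rewrite inE => -[xv xu].
    by rewrite mulrC; apply: convolution_slicer => //; rewrite xu.
  by rewrite -bu (hom_sum_mulr (fun y => c * f y)) hom_sumZ// f0 mulr0.
Qed.

(** Among the arrows from [u] to [u] only [u] is a unit. Hence the kernel contains no nonzero
    multiple of [\1_K] for nonempty [K]. *)
Lemma hom_sum_indic_unit K u : K `<=` unit_space G -> K u -> hom_sum \1_K u u = 1.
Proof.
move=> KG Ku; rewrite /hom_sum (@fsbig_single _ _ _ _ u) ?indic_in//.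
  by split; [rewrite unit_rngE//|rewrite unit_srcE//]; exact: KG.
move=> y [yu _] ny; rewrite indic_out// => Ky; apply: ny.
by rewrite -yu unit_rngE//; exact: KG.
Qed.

(** An arrow of isotropy acts on the free module as its range does, so [\1_B] and the indicator of
    the range of [B] have the same matrix. They differ as functions because [B] avoids the units. *)
Lemma basically_simple_effective : basically_simple R G -> effective G.
Proof.
move=> simpleG; apply/seteqP; split=> // x.
move=> /(ex_slice ampleG) [B [sB Bx BI]].
have [cB oB irB _] := sB.
set I := [set f | steinberg R G f /\ forall u v, hom_sum f u v = 0].
have I0 (r : R) K : compact K -> open K -> K `<=` unit_space G ->
    I (fun y => r * \1_K y) -> r != 0 -> K = set0.
  move=> cK oK KG [_ rK] r0; apply/seteqP; split=> // u Ku.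
  have := rK u u; rewrite hom_sumZ; last exact: steinberg_indic1.
  by rewrite hom_sum_indic_unit// mulr1 => re; rewrite re eqxx in r0.
have bI : basic_ideal I.
  split; first exact: hom_sum_ideal.
  (* The basic condition is met because [K] is forced to be empty. *)
  move=> r K r0 cK oK KG rK; rewrite (I0 r K)// indic0.
  by split; [exact: steinberg0|move=> u v; exact: fsbig1].
have cr : compact (rg @` B) by exact: compact_image_rng.
have or : open (rg @` B) by exact: open_image_rng.
have rG : rg @` B `<=` unit_space G by move=> _ [y _ <-]; exact: unit_rng.
have [IE|IE] := simpleG I bI.
  suff : I (\1_B - \1_(rg @` B)).
    rewrite IE => /(congr1 (fun f => f x)).
    rewrite -[LHS]/(\1_B x - \1_(rg @` B) x) indic_in// indic_out; last first.
      by move=> /rG; have [_] := BI _ Bx.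
    by move/eqP; rewrite subr0 -[X in _ == X]/(0 : R) oner_eq0.
  split=> [|u v]; first by apply: steinbergB => //; exact: steinberg_indic1.
  rewrite hom_sumB//; [|exact: steinberg_indic1|exact: steinberg_indic1].
  apply/eqP; rewrite subr_eq0; apply/eqP.
  (* At a diagonal entry over the range of [B] both sums are [1], from one arrow of [B] and one
     unit; all other entries vanish. *)
  have [[uv [b Bb bv]]|nuv] := pselect (u = v /\ (rg @` B) v).
    have [bI' _] := BI _ Bb.
    rewrite uv [RHS]hom_sum_indic_unit//; last by exists b.
    rewrite /hom_sum (@fsbig_single _ _ _ _ b) ?indic_in//.
      by split=> //; rewrite bI'.
    move=> y [yv _] ny; rewrite indic_out// => By; apply: ny.
    by apply: irB; rewrite ?inE// yv.
  rewrite /hom_sum !fsbig1// => y [yv yu]; rewrite indic_out//.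
    move=> rBy; apply: nuv; split; last by rewrite -yv unit_rngE//; exact: rG.
    by rewrite -yu -yv unit_srcE ?unit_rngE//; exact: rG.
  move=> By; apply: nuv; have [yI _] := BI _ By.
  by split; [rewrite -yu -yv yI|exists y].
have : rg @` B = set0.
  apply: (I0 1) => //; last exact: oner_neq0.
  by rewrite IE; exact: steinberg_indic.
by move=> /seteqP[/(_ (rg x)) + _]; apply; exists x.
Qed.

End basic_simplicity.

Theorem theorem4p1 (R : comNzRingType) (G : topologicalGroupoidType)
  (hausdorffG : hausdorff_space G) (ampleG : ample G) :
  basically_simple R G <-> effective G /\ minimal G.
Proof.
split=> [simpleG|[effG minG] I bI].
  split; first exact: (basically_simple_effective hausdorffG ampleG simpleG).
  exact: (basically_simple_minimal hausdorffG ampleG simpleG).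
have [idI _] := bI.
have [I0|] := pselect (I `<=` [set 0]).
  by left; apply/seteqP; split=> // _ ->; case: idI.
move=> /existsNP[f /not_implyP[If f0]]; right.
have [K [cK oK KG K0 IK]] := ideal_unit_indic hausdorffG ampleG effG bI If f0.
exact: (minimal_ideal_full hausdorffG ampleG minG idI cK oK KG K0 IK).
Qed.
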